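(* Let $\Delta$ be a positive integer and let $\beta$ be a real number such that at least one of the following three conditions holds: (i) $\Delta\ge 6.5\cdot 10^7$ and $0.6550826\,\Delta\le \beta\le \Delta$; (ii) $\Delta\ge 4000$ and $\tfrac{2}{3}\Delta\le \beta\le \Delta$; (iii) $\Delta\ge 750$ and $0.8\,\Delta\le \beta\le \Delta$. Let $a:=\lceil \Delta+\beta+\sqrt{\Delta}\,\rceil$. If $G$ is a graph with maximum degree at most $\Delta$ and $L$ is an $a$-assignment for $G$, then there are at least $\beta^{|V(G)|}$ proper conflict-free $L$-colorings of $G$.
   Context: Graphs are finite and simple. A coloring of a graph $G$ is a map $\varphi\colon V(G)\to\mathbb{Z}^+$; it is proper if $\varphi(v)\neq\varphi(w)$ for every edge $vw$. A proper conflict-free coloring of $G$ is a proper coloring of $G$ such that for every non-isolated vertex $v$ some color is used by $\varphi$ on exactly one vertex of the open neighborhood $N(v)$. A list-assignment $L$ for $G$ assigns to each vertex $v$ a set $L(v)\subseteq\mathbb{Z}^+$ of allowable colors; for a real number $a$, an $a$-assignment is a list-assignment with $|L(v)|\ge a$ for all $v\in V(G)$. An $L$-coloring is a coloring $\varphi$ with $\varphi(v)\in L(v)$ for all $v\in V(G)$. *)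

(* Defs.v *)
From mathcomp Require Import all_boot all_order all_algebra.
From mathcomp Require Import all_classical all_reals all_analysis.

Set Implicit Arguments.
Unset Strict Implicit.
Unset Printing Implicit Defensive.

Local Open Scope classical_set_scope.
Local Open Scope ring_scope.

Record sgraph := SGraph {
  vertex :> finType;
  adj : rel vertex;
  adj_sym : symmetric adj;
  adj_irrefl : irreflexive adj
}.

Definition neighbors (G : sgraph) (v : G) : {set G} := [set w | adj v w]%SET.

Definition max_degree (G : sgraph) : nat := (\max_(v : G) #|neighbors v|)%N.

Definition color := {n : nat | (0 < n)%N}.

Definition coloring (G : sgraph) := {ffun G -> color}.

Definition proper (G : sgraph) (phi : coloring G) : Prop :=
  forall v w : G, adj v w -> phi v != phi w.

Definition proper_conflict_free (G : sgraph) (phi : coloring G) : Prop :=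
  proper phi /\
  forall v : G, neighbors v != finset.set0 ->
    exists c : color, #|[set w in neighbors v | phi w == c]%SET| = 1%N.

Definition list_assignment (G : sgraph) := G -> set color.

(* [L v] may be infinite, in which case [counting (L v)] is +oo. *)
Definition is_assignment (R : realType) (a : R) (G : sgraph)
    (L : list_assignment G) : Prop :=
  forall v : G, (a%:E <= counting (L v))%E.

Definition is_list_coloring (G : sgraph) (L : list_assignment G)
    (phi : coloring G) : Prop :=
  forall v : G, L v (phi v).

(* Main.v *)
Require Import Defs.
From mathcomp Require Import all_boot all_order all_algebra.
From mathcomp Require Import all_classical all_reals all_analysis.
From mathcomp Require Import ring lra.

Set Implicit Arguments.
Unset Strict Implicit.
Unset Printing Implicit Defensive.

Import Order.TTheory GRing.Theory Num.Theory.

Local Open Scope ring_scope.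

(** The proof is a Rosenfeld-type count.  Fix finite lists and let [C(U)] be the
    number of list-colorings of a vertex set [U] that are proper and in which no
    open neighborhood contained in [U] is repetitive, i.e. has every color
    repeated.  The aim is [b * C(U - v) <= C(U)] for all [v] in [U], by induction
    on the size of [U]; multiplying these gives [b ^ #|U| <= C(U)].

    A coloring counted by [C(U - v)] extends to [v] in at least
    [#|L v| - D >= b + sqrt D] proper ways, so it suffices that for each of the
    at most [D] neighborhoods [e] through [v], at most [C(U - v) / sqrt D]
    extensions make [e] repetitive.  Such an extension is determined by less
    data: either the color of [v] occurs at least three times on [e], and then
    [e - v] is already repetitive and uses at most half as many colors as it has
    vertices; or the color of [v] is that of exactly one [u] in [e], and
    [e - v - u] is repetitive.  As every vertex removed costs a factor [b] in
    the count, iterating this bounds the extensions by [b * a_k * C(U - v)],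
    where [k] is the size of [e] and [a] is [repeat_weight], defined by
      [a_0 = 1], [a_1 = 0], [a_(k+1) = (k / b) * (a_k / 2 + a_(k-1))].

    The numerical task is [D * b * a_k <= sqrt D] for [3 <= k <= D]
    ([repeat_weight_small]).  Here [a_k ^ 2] is at most
    [k! / b ^ k * exp (k (k + 1) / (8 b) + k / 4)], whose factorial part is
    log-convex in [k], so that for [k >= 4] only [k = 4] and [k = D] matter.  At
    [k = 4] the bound is of order [1 / b ^ 4]; at [k = D] it is exponentially
    small as soon as [b >= 0.655 D], which follows from each of the three ranges
    of the statement.  For [k = 3] the exact value [a_3 = 1 / b ^ 2] is used.

    The bound fails for [k = 2], where a repetitive neighborhood is just a
    forbidden equality of two colors.  A vertex [w] with exactly two neighbors
    [x] and [y] is therefore handled apart: delete [w], join [x] to [y], count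
    by induction, and color [w] last.  The new edge makes the neighborhood of
    [w] conflict-free, and [w] only has to avoid the colors of [x] and [y] and,
    for each of these two, at most [D / 2] colors that would leave its
    neighborhood repetitive ([admissible_uncontract]). *)

(** * Weights of repetitive sets *)

Section Weight.
Variable R : realType.
Implicit Types (b x y p : R) (n k : nat).

(** Among the admissible colorings, [repeat_weight b k] bounds the proportion that
    is repetitive on a fixed set of [k] vertices; the recurrence mirrors
    [card_repetitive_extensions]. *)
Fixpoint repeat_weight b n : R :=
  match n with
  | 0 => 1
  | n1.+1 => match n1 with
             | 0 => 0
             | n2.+1 => n1%:R / b * (repeat_weight b n1 / 2 + repeat_weight b n2)
             end
  end.

Lemma repeat_weightSS b n :
  repeat_weight b n.+2
  = n.+1%:R / b * (repeat_weight b n.+1 / 2 + repeat_weight b n).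
Proof. by []. Qed.

Lemma repeat_weight_ge0 b n : 0 < b -> 0 <= repeat_weight b n.
Proof.
move=> b0; suff: 0 <= repeat_weight b n /\ 0 <= repeat_weight b n.+1 by case.
elim: n => [|n [IH1 IH2]]; first by split; rewrite /= ?ler01.
split=> //; rewrite repeat_weightSS mulr_ge0 ?divr_ge0 ?addr_ge0 ?(ltW b0)//.
exact: divr_ge0.
Qed.

Lemma expR_ge_quadratic y : 0 <= y -> 1 + y + y ^+ 2 / 2 <= expR y.
Proof.
move=> y0.
have nd : nondecreasing_seq (series (exp_coeff y)).
  apply/nondecreasing_seqP => n; rewrite seriesSr lerDl.
  by rewrite /exp_coeff /= divr_ge0// exprn_ge0.
have := nondecreasing_cvgn_le nd (is_cvg_series_exp_coeff y) 3%N.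
apply: le_trans; rewrite !seriesSr /series /= big_geq//.
by rewrite /exp_coeff /= add0r expr0 expr1 !divr1.
Qed.

(** The square of a supersolution of the recurrence of [repeat_weight].  Writing
    [p = sqrt (k / b)], its root grows by the factor
    [p * exp ((p ^ 2 + 1) / 8) >= p * exp (p / 4)] from [k - 1] to [k].  The optimal
    factor is [p * exp (arsinh (p / 4))]; the slightly larger one used here
    multiplies up to a closed formula. *)
Definition majorant b k : R :=
  k`!%:R / b ^+ k * expR (k%:R * k.+1%:R / (8 * b) + k%:R / 4).

Definition majorant_ratio p : R := expR ((p ^+ 2 + 1) / 8).

(** With [y = p / 4] this is [2 * y <= s - s^-1], which holds for
    [s >= exp y] since [y <= sinh y]. *)
Lemma majorant_ratioP p : 0 <= p ->
  p / 2 * majorant_ratio p + 1 <= majorant_ratio p ^+ 2.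
Proof.
move=> p0; set s := majorant_ratio p.
have q0 : 0 <= p / 4 by apply: divr_ge0.
have : 1 + p / 4 + (p / 4) ^+ 2 / 2 <= s.
  apply: le_trans (expR_ge_quadratic q0) _.
  by rewrite ler_expR; have := sqr_ge0 (p - 1); lra.
set t := (X in X <= s) => ts.
have t1 : 1 + p / 4 <= t by rewrite /t lerDl divr_ge0 ?sqr_ge0.
have t2 : p / 2 * t + 1 <= t ^+ 2.
  have -> : t ^+ 2 = p / 2 * t + 1 + (p / 4) ^+ 4 / 4 by rewrite /t; field.
  by rewrite lerDl divr_ge0// exprn_ge0.
have d0 : 0 <= (s - t) * (s + t - p / 2) by apply: mulr_ge0; lra.
have -> : s ^+ 2 = t ^+ 2 + (s - t) * (s + t - p / 2) + p / 2 * (s - t) by ring.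
lra.
Qed.

Lemma majorant0 b : majorant b 0 = 1.
Proof. by rewrite /majorant fact0 expr0 divr1 mul1r !mul0r addr0 expR0. Qed.

Lemma majorantS b k : 0 < b ->
  majorant b k.+1
  = majorant b k * ((k.+1%:R / b) * expR ((k.+1%:R / b + 1) / 8) ^+ 2).
Proof.
move=> b0; rewrite /majorant -expRM_natl factS exprSr natrM.
have -> : k.+1%:R * k.+2%:R / (8 * b) + k.+1%:R / 4
  = (k%:R * k.+1%:R / (8 * b) + k%:R / 4) + 2 * ((k.+1%:R / b + 1) / 8) :> R.
  by rewrite -[k.+2%:R]natr1 -[k.+1%:R]natr1; field; rewrite gt_eqF.
by rewrite expRD; field; rewrite expf_neq0 gt_eqF.
Qed.

Lemma majorant_gt0 b k : 0 < b -> 0 < majorant b k.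
Proof.
move=> b0; rewrite /majorant mulr_gt0 ?expR_gt0// divr_gt0 ?exprn_gt0//.
Qed.

Lemma repeat_weight_le_majorant b k : 0 < b ->
  repeat_weight b k <= Num.sqrt (majorant b k).
Proof.
move=> b0.
suff: repeat_weight b k <= Num.sqrt (majorant b k) /\
      repeat_weight b k.+1 <= Num.sqrt (majorant b k.+1) by case.
elim: k => [|k [IH0 IH1]].
  split; last by rewrite /= sqrtr_ge0.
  by rewrite majorant0 sqrtr1.
split=> //; rewrite repeat_weightSS.
set x := k.+1%:R / b.
have x0 : 0 <= x by rewrite divr_ge0// ltW.
set p := Num.sqrt x; have p0 : 0 <= p := sqrtr_ge0 _.
have pE : p ^+ 2 = x by rewrite sqr_sqrtr.
set s := majorant_ratio p.
have s0 : 0 < s by apply: expR_gt0.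
have M0 : 0 <= majorant b k by rewrite ltW ?majorant_gt0.
have E1 : Num.sqrt (majorant b k.+1) = Num.sqrt (majorant b k) * (p * s).
  rewrite majorantS// -/x sqrtrM// [Num.sqrt (x * _)]sqrtrM// sqrtr_sqr gtr0_norm ?expR_gt0//.
  by rewrite /s /majorant_ratio pE.
have E2 : Num.sqrt (majorant b k) * (x * s ^+ 2) <= Num.sqrt (majorant b k.+2).
  have -> : Num.sqrt (majorant b k) * (x * s ^+ 2)
    = Num.sqrt (majorant b k.+1) * (p * s) by rewrite E1 -pE; ring.
  rewrite (majorantS k.+1)// [leRHS]sqrtrM ?(ltW (majorant_gt0 _ _))//.
  rewrite ler_wpM2l ?sqrtr_ge0//.
  have xx' : x <= k.+2%:R / b by rewrite ler_pM2r ?invr_gt0// ler_nat.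
  have <- : Num.sqrt (x * s ^+ 2) = p * s.
    by rewrite sqrtrM// sqrtr_sqr gtr0_norm.
  have x1 : 0 <= k.+2%:R / b by rewrite divr_ge0// ltW.
  rewrite ler_sqrt; last by apply: mulr_ge0; rewrite ?sqr_ge0.
  apply: ler_pM; rewrite ?sqr_ge0// lerXn2r ?nnegrE ?expR_ge0//.
  by rewrite /s /majorant_ratio pE ler_expR ler_pM2r// lerD2r.
apply: le_trans E2.
have := majorant_ratioP p0; rewrite -/s => Hs.
apply: (@le_trans _ _ (x * (Num.sqrt (majorant b k) * (p / 2 * s + 1)))).
  rewrite ler_wpM2l//.
  rewrite E1 in IH1; nra.
by rewrite mulrCA ler_wpM2l ?sqrtr_ge0// ler_wpM2l.
Qed.

(** A form of Stirling's bound: the quotient of consecutive right-hand sides is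
    at least [n.+2] because [exp (1 / m) <= m / (m - 1)]. *)
Lemma fact_le_exp n : n.+1`!%:R <= n.+1%:R ^+ n.+2 * expR (- n%:R) :> R.
Proof.
elim: n => [|n IH]; first by rewrite oppr0 expR0 mulr1 expr1n.
have n0 : (0 : R) < n.+1%:R by rewrite ltr0n.
have n1 : (0 : R) < n.+2%:R by rewrite ltr0n.
rewrite factS natrM [in leRHS]exprS -mulrA ler_pM2l//.
apply: le_trans IH _.
have -> : - n.+1%:R = - n%:R - 1 :> R by rewrite -[n.+1%:R]natr1 opprD.
rewrite expRD [leRHS]mulrCA [leLHS]mulrC ler_wpM2l ?expR_ge0//.
have e1 : n.+1%:R / n.+2%:R <= expR (- n.+2%:R^-1) :> R.
  apply: le_trans (expR_ge1Dx _).
  rewrite ler_pdivrMr// mulrDl mul1r mulNr mulVf ?gt_eqF//.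
  by rewrite -[n.+2%:R]natr1 addrK.
have -> : expR (-1) = expR (- n.+2%:R^-1) ^+ n.+2 :> R.
  by rewrite -expRM_natl mulrN mulfV ?gt_eqF.
rewrite -ler_pdivrMl ?exprn_gt0// mulrC -expr_div_n.
by rewrite lerXn2r ?nnegrE ?divr_ge0 ?expR_ge0// ltW.
Qed.

(** The sequence [k! * x ^ k] is log-convex, its ratios [k * x] being increasing,
    so on an interval it is largest at an end. *)
Lemma fact_exp_le_ends x m k n : 0 <= x -> (m <= k <= n)%N ->
  k`!%:R * x ^+ k <= m`!%:R * x ^+ m + n`!%:R * x ^+ n.
Proof.
move=> x0 /andP[mk kn].
have step j : j.+1`!%:R * x ^+ j.+1 = (j.+1%:R * x) * (j`!%:R * x ^+ j).
  by rewrite factS natrM exprS; ring.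
have t0 j : 0 <= j`!%:R * x ^+ j by rewrite mulr_ge0 ?exprn_ge0.
have [kx|/ltW kx] := leP (k%:R * x) 1.
  rewrite -[leLHS]addr0 lerD//.
  have {kn} : k%:R * x <= 1 by [].
  rewrite -(subnKC mk); elim: (k - m)%N => [|j IH]; first by rewrite addn0.
  rewrite addnS => jx; rewrite step.
  have jx' : (m + j)%:R * x <= 1.
    by apply: le_trans jx; rewrite ler_wpM2r// ler_nat.
  by apply: le_trans (IH jx'); rewrite ler_piMl.
rewrite -[leLHS]add0r lerD//.
rewrite -(subnKC kn); elim: (n - k)%N => [|j IH]; first by rewrite addn0.
rewrite addnS step; apply: le_trans IH _; rewrite ler_peMl//.
by apply: le_trans kx _; rewrite ler_wpM2r// ler_nat -addnS leq_addr.
Qed.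

Lemma expR1_le3 : expR 1 <= 3 :> R.
Proof.
have : (1 - 6^-1) ^+ 6 <= expR (-1) :> R.
  have -> : -1 = 6 * - 6^-1 :> R by field.
  by rewrite expRM_natl lerXn2r ?nnegrE ?expR_ge0 ?expR_ge1Dx//; lra.
rewrite expRN => H; have := expR_gt0 (1 : R) => e0.
have : (1 - 6^-1) ^+ 6 * expR 1 <= 1 :> R by rewrite -ler_pdivlMr// div1r.
lra.
Qed.

Lemma majorant_le_fact_exp D b k : 0 < b -> (k <= D)%N ->
  majorant b k <= k`!%:R * (expR (D.+1%:R / (8 * b) + 4^-1) / b) ^+ k.
Proof.
move=> b0 kD; rewrite expr_div_n -expRM_natl /majorant -mulrA.
rewrite [_^-1 * _]mulrC ler_wpM2l// ler_wpM2r ?invr_ge0 ?exprn_ge0 ?(ltW b0)//.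
rewrite ler_expR mulrDr mulrA lerD2r.
by rewrite ler_wpM2r ?invr_ge0 ?mulr_ge0 ?(ltW b0)// ler_wpM2l// ler_nat ltnS.
Qed.

Section Large.
Variables (D : nat) (b : R).
Hypothesis D_ge : (750 <= D)%N.
Hypothesis b_ge : 655 / 1000 * D%:R <= b.

Lemma largeD : 750 <= D%:R :> R.
Proof. by rewrite ler_nat. Qed.

Lemma large_b_gt0 : 0 < b.
Proof. by have := largeD; have := b_ge; lra. Qed.

Lemma large_ratio : D%:R / b <= 1527 / 1000.
Proof.
by rewrite ler_pdivrMr ?large_b_gt0//; have := largeD; have := b_ge; lra.
Qed.

Lemma large_exponent : D.+1%:R / (8 * b) + 4^-1 <= 442 / 1000 :> R.
Proof.
have b0 := large_b_gt0.
rewrite -lerBrDr ler_pdivrMr ?mulr_gt0//.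
by have := largeD; have := b_ge; rewrite -[D.+1%:R]natr1; lra.
Qed.

(** The factor [D * b ^ 2] is what squaring [D * b * a_k <= sqrt D] and dividing
    by [D] leaves. *)
Lemma quartic_term_small :
  D%:R * b ^+ 2 * (4`!%:R * (expR (D.+1%:R / (8 * b) + 4^-1) / b) ^+ 4) <= 7 / 10.
Proof.
have b0 := large_b_gt0; have dD := largeD.
set E := expR _.
have E4 : E ^+ 4 <= 9.
  rewrite /E -expRM_natl; apply: (@le_trans _ _ (expR 1 ^+ 2)).
    by rewrite -expRM_natl ler_expR; have := large_exponent; lra.
  have -> : 9 = 3 ^+ 2 :> R by ring.
  by rewrite lerXn2r ?nnegrE ?expR_ge0 ?expR1_le3.
have -> : 4`!%:R = 24 :> R by [].
have -> : D%:R * b ^+ 2 * (24 * (E / b) ^+ 4) = (24 * D%:R * E ^+ 4) / b ^+ 2.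
  by field; rewrite gt_eqF.
rewrite ler_pdivrMr ?exprn_gt0//.
apply: (@le_trans _ _ (24 * D%:R * 9)); first by rewrite ler_wpM2l//; lra.
have [c cE] : exists2 c : R, c = 655 / 1000 * D%:R & c <= b.
  by eexists; [reflexivity | exact: b_ge].
move=> cb; have c0 : 0 <= c by lra.
have : c * c <= b ^+ 2 by rewrite expr2 ler_pM.
have : 750 * D%:R <= D%:R ^+ 2 :> R by rewrite expr2 ler_wpM2r.
by rewrite cE; lra.
Qed.

(** By Stirling's bound the left-hand side is at most [3 * D ^ 4] times the [D]-th
    power of [(D / b) * exp (0.442 - 1)].  Since [D / b <= 1.527 <= exp 0.45], this
    base is below [exp (- 1 / 10)], and from [D = 750] on the exponential beats
    the polynomial. *)
Lemma top_term_small : b <= D%:R ->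
  D%:R * b ^+ 2 * (D`!%:R * (expR (D.+1%:R / (8 * b) + 4^-1) / b) ^+ D) <= 3 / 10.
Proof.
move=> bD; have b0 := large_b_gt0; have dD := largeD; have xx := large_exponent.
set E := expR _; have E0 : 0 < E by apply: expR_gt0.
have f1 : D`!%:R <= D%:R ^+ D.+1 * (expR (- D%:R) * 3) :> R.
  case: (D) D_ge => // n _; apply: le_trans (fact_le_exp n) _.
  rewrite ler_wpM2l ?exprn_ge0//.
  have -> : - n%:R = - n.+1%:R + 1 :> R by rewrite -[n.+1%:R]natr1; ring.
  by rewrite expRD ler_wpM2l ?expR_ge0 ?expR1_le3.
have r1 : D%:R / b * E * expR (- 1) <= expR (- (1 / 10)).
  have q : D%:R / b <= expR (45 / 100).
    apply: le_trans large_ratio _.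
    by apply: le_trans (expR_ge_quadratic _); lra.
  apply: (@le_trans _ _ (expR (45 / 100) * E * expR (-1))).
    by rewrite !ler_wpM2r ?expR_ge0.
  by rewrite -!expRD ler_expR; lra.
have r2 : D%:R ^+ D * (expR (- D%:R) * (E / b) ^+ D)
        <= ((1 + D%:R / 200) ^+ 20)^-1 :> R.
  have -> : expR (- D%:R) = expR (-1) ^+ D :> R by rewrite -expRM_natr mulN1r.
  rewrite -!exprMn_comm; do ?exact: mulrC.
  have -> : D%:R * (expR (-1) * (E / b)) = D%:R / b * E * expR (-1) by ring.
  apply: (@le_trans _ _ (expR (- (1 / 10)) ^+ D)).
    rewrite lerXn2r ?nnegrE ?expR_ge0//.
    by rewrite !mulr_ge0 ?expR_ge0 ?invr_ge0 ?(ltW b0) ?(ltW E0)//; lra.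
  (* The exponential is taken as a 20th power, so that the polynomial [D ^ 4] can
     be beaten by comparing [D] with a fifth power. *)
  have -> : expR (- (1 / 10)) ^+ D = (expR (D%:R / 200) ^+ 20)^-1 :> R.
    by rewrite -expRM_natr -expRM_natl -expRN; congr expR; field.
  have u0 : 0 < 1 + D%:R / 200 :> R by lra.
  rewrite lef_pV2 ?posrE ?exprn_gt0 ?expR_gt0//.
  by apply: lerXn2r; rewrite ?nnegrE ?expR_ge0 ?expR_ge1Dx ?(ltW u0).
have r3 : D%:R ^+ 4 * 3 <= 3 / 10 * (1 + D%:R / 200) ^+ 20 :> R.
  set u : R := D%:R / 200.
  have u1 : 375 / 100 <= u by rewrite /u; lra.
  have -> : D%:R = 200 * u :> R by rewrite /u; field.
  have u5 : 2 * (200 * u) <= (1 + u) ^+ 5.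
    have v4 : (9 / 2) ^+ 4 <= (1 + u) ^+ 4.
      by apply: lerXn2r; rewrite ?nnegrE; lra.
    apply: (@le_trans _ _ ((1 + u) * (9 / 2) ^+ 4)); first lra.
    by rewrite exprS; apply: ler_wpM2l v4; lra.
  have : (2 * (200 * u)) ^+ 4 <= ((1 + u) ^+ 5) ^+ 4.
    by apply: lerXn2r u5; rewrite ?nnegrE; [|apply: exprn_ge0]; lra.
  rewrite -exprM; have -> : (5 * 4)%N = 20%N by [].
  have : 0 <= (200 * u) ^+ 4 by apply: exprn_ge0; lra.
  have -> : (2 * (200 * u)) ^+ 4 = 16 * (200 * u) ^+ 4 by ring.
  lra.
apply: (@le_trans _ _ (D%:R ^+ 4 * 3 *
    (D%:R ^+ D * (expR (- D%:R) * (E / b) ^+ D)))).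
  have Eb : 0 <= (E / b) ^+ D by rewrite exprn_ge0// divr_ge0// ltW.
  have -> : D%:R ^+ 4 * 3 * (D%:R ^+ D * (expR (- D%:R) * (E / b) ^+ D)) =
     (D%:R * D%:R ^+ 2) * ((D%:R ^+ D.+1 * (expR (- D%:R) * 3)) * (E / b) ^+ D).
    by rewrite (exprS _ D); ring.
  have b2 : b ^+ 2 <= D%:R ^+ 2 by rewrite lerXn2r ?nnegrE ?(ltW b0).
  apply: ler_pM; first by rewrite mulr_ge0// sqr_ge0.
  - exact: mulr_ge0.
  - exact: ler_wpM2l.
  - exact: ler_wpM2r.
apply: (@le_trans _ _ (D%:R ^+ 4 * 3 * ((1 + D%:R / 200) ^+ 20)^-1)).
  by rewrite ler_wpM2l// mulr_ge0 ?exprn_ge0.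
rewrite ler_pdivrMr// exprn_gt0//; lra.
Qed.

Lemma repeat_weight_small k : b <= D%:R -> (3 <= k <= D)%N ->
  D%:R * (b * repeat_weight b k) <= Num.sqrt D%:R.
Proof.
move=> bD /andP[k3 kD]; have b0 := large_b_gt0; have dD := largeD.
have sq : 2 <= Num.sqrt D%:R :> R.
  have -> : 2 = Num.sqrt (2 ^+ 2) :> R by rewrite sqrtr_sqr ger0_norm.
  by rewrite ler_sqrt//; lra.
have w0 := repeat_weight_ge0 k b0.
have [k4|k4] := ltnP 3 k; last first.
  have -> : k = 3%N by apply/eqP; rewrite eqn_leq k4.
  have -> : D%:R * (b * repeat_weight b 3) = D%:R / b.
    by rewrite /=; field; rewrite gt_eqF.
  by have := large_ratio; lra.
rewrite -[leLHS]ger0_norm ?mulr_ge0 ?(ltW b0)// -sqrtr_sqr ler_sqrt//.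
have -> : (D%:R * (b * repeat_weight b k)) ^+ 2
  = D%:R * (D%:R * b ^+ 2 * repeat_weight b k ^+ 2) by ring.
rewrite -[leRHS]mulr1 ler_wpM2l//.
have c0 : 0 <= D%:R * b ^+ 2 by rewrite mulr_ge0 ?sqr_ge0.
apply: (@le_trans _ _ (D%:R * b ^+ 2 * majorant b k)).
  rewrite ler_wpM2l// -[majorant b k]sqr_sqrtr ?(ltW (majorant_gt0 k b0))//.
  by rewrite lerXn2r ?nnegrE ?sqrtr_ge0 ?repeat_weight_le_majorant.
have := majorant_le_fact_exp b0 kD; set E := expR _ => mE.
have E0 : 0 <= E / b by rewrite divr_ge0 ?expR_ge0 ?(ltW b0).
have := @fact_exp_le_ends (E / b) 4 k D E0; rewrite k4 kD => /(_ isT) ends.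
have := ler_wpM2l c0 (le_trans mE ends).
rewrite mulrDr; have := quartic_term_small; have := top_term_small bD.
rewrite -/E; lra.
Qed.
End Large.
End Weight.

(** * Colorings of vertex subsets *)

Section Colorings.
(* Here [set0], [subsetP] and the like refer to finite sets, not to predicates. *)
Import mathcomp.boot.fintype mathcomp.boot.finset.
Variables (V K : finType) (k0 : K) (L : V -> {set K}).
Implicit Types (U W e S : {set V}) (f g : {ffun V -> K}) (u v w x y : V) (c : K).
Implicit Types adj : rel V.

Definition recolor f v c := [ffun x => if x == v then c else f x].

Lemma recolorE f v c x : recolor f v c x = if x == v then c else f x.
Proof. by rewrite ffunE. Qed.

Lemma recolor_id f v c : recolor (recolor f v c) v (f v) = f.
Proof. by apply/ffunP => x; rewrite !recolorE; case: eqP => // ->. Qed.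

(** A coloring of [U] is encoded as a total function with the value [k0] off [U],
    so that [recolor _ v k0] uncolors [v] and restrictions to different sets all
    live in one finite type. *)
Definition list_colorings U :=
  [set f : {ffun V -> K} | [forall x, if x \in U then f x \in L x else f x == k0]]%SET.

Lemma list_coloringsP U f :
  reflect ((forall x, x \in U -> f x \in L x) /\ (forall x, x \notin U -> f x = k0))
          (f \in list_colorings U).
Proof.
rewrite inE; apply: (iffP forallP) => [H|[H1 H2] x].
  by split=> x; have := H x; case: ifP => // _ /eqP.
by case: ifP => [/H1//|/negbT/H2 ->].
Qed.

Lemma erase_list_colorings U v f :
  f \in list_colorings U -> recolor f v k0 \in list_colorings (U :\ v).
Proof.
move=> /list_coloringsP[H1 H2]; apply/list_coloringsP; split=> x.
  by rewrite !inE recolorE => /andP[/negbTE-> /H1].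
by rewrite !inE recolorE negb_and negbK; case: eqP => //= _ /H2.
Qed.

Definition repetitive f e :=
  [forall u in e, [exists u' in e, (u' != u) && (f u' == f u)]].

Lemma repetitiveP f e :
  reflect (forall u, u \in e -> exists u', [/\ u' \in e, u' != u & f u' = f u])
          (repetitive f e).
Proof.
apply: (iffP 'forall_implyP) => H u ue.
  by have /existsP[u' /and3P[? ? /eqP]] := H u ue; exists u'.
by have [u' [? ? /eqP ?]] := H u ue; apply/existsP; exists u'; apply/and3P.
Qed.

Lemma eq_repetitive f g e : {in e, f =1 g} -> repetitive f e = repetitive g e.
Proof.
by move=> fg; apply/repetitiveP/repetitiveP => H u ue;
  have [u' [? ? E]] := H u ue; exists u'; split=> //; move: E; rewrite !fg.
Qed.

Lemma repetitive1 f u : ~~ repetitive f [set u].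
Proof.
apply/repetitiveP => /(_ u (set11 u)) [u' []].
by rewrite inE => /eqP ->; rewrite eqxx.
Qed.

Lemma repetitive_few_colors f e : repetitive f e -> (#|f @: e| <= #|e|./2)%N.
Proof.
move=> /repetitiveP rep; rewrite geq_half_double -muln2 -sum_nat_const.
rewrite -[X in (_ <= X)%N]sum1_card (partition_big_imset f)/=.
apply: leq_sum => _ /imsetP[u ue ->]; have [u' [u'e u'u fu']] := rep u ue.
rewrite (bigD1 u) ?ue ?eqxx//= (bigD1 u') ?u'e ?fu' ?eqxx ?u'u//=.
Qed.

Lemma leq_card_bigcup (T I : finType) (P : pred I) (F : I -> {set T}) :
  (#|\bigcup_(i | P i) F i| <= \sum_(i | P i) #|F i|)%N.
Proof.
elim/big_ind2: _ => //; first by rewrite cards0.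
by move=> m A n B Am Bn; apply: leq_trans (leq_add Am Bn); rewrite leq_card_setU.
Qed.

Lemma card_dep_pairs (T T' : finType) (A : {set T}) (F : T -> {set T'}) :
  #|[set p : T * T' | (p.1 \in A) && (p.2 \in F p.1)]| = (\sum_(a in A) #|F a|)%N.
Proof.
rewrite -sum1_card (eq_bigl (fun p : T * T' => (p.1 \in A) && (p.2 \in F p.1))).
  rewrite -(pair_big_dep (mem A) (fun a b => b \in F a) (fun _ _ => 1%N)).
  by apply: eq_bigr => a _; rewrite sum1_card.
by move=> p; rewrite inE.
Qed.

(** Each [g] in [A] has at least [#|L v| - m] extensions to [v], and different
    pairs of [g] and a color give different extensions because [g v = k0]. *)
Lemma leq_card_extensions (A S : {set {ffun V -> K}}) v (F : {ffun V -> K} -> {set K}) m :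
  (forall g, g \in A -> g v = k0) ->
  (forall g, g \in A -> (#|F g| <= m)%N) ->
  (forall g c, g \in A -> c \in L v -> c \notin F g -> recolor g v c \in S) ->
  (#|A| * (#|L v| - m) <= #|S|)%N.
Proof.
move=> Av Fm AS.
pose P := [set p : {ffun V -> K} * K | (p.1 \in A) && (p.2 \in L v :\: F p.1)]%SET.
have cP : (#|A| * (#|L v| - m) <= #|P|)%N.
  rewrite /P (card_dep_pairs A (fun g => L v :\: F g)%SET) -sum_nat_const.
  apply: leq_sum => g /Fm Fg; rewrite cardsD.
  by rewrite leq_sub2l// (leq_trans _ Fg)// subset_leq_card// subsetIr.
have inj : {in P &, injective (fun p : {ffun V -> K} * K => recolor p.1 v p.2)}.
  move=> [g c] [g' c']; rewrite !inE /= => /andP[gA _] /andP[gA' _] /ffunP E.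
  congr (_, _); last by have := E v; rewrite !recolorE eqxx.
  apply/ffunP => x; have := E x; rewrite !recolorE.
  by case: eqP => // -> _; rewrite !Av.
apply: leq_trans cP _; rewrite -(card_in_imset inj); apply: subset_leq_card.

apply/subsetP => _ /imsetP[[g c] /[!inE]/= /andP[gA /andP[cF cL]] ->].
exact: AS.
Qed.

(** * Counting admissible colorings *)

Section Rosenfeld.
Variables (adj : rel V) (E : V -> {set V}).

Definition proper_in U f := [forall x in U, forall y in U, adj x y ==> (f x != f y)].

(** The sets [E w] are the conflict sets, indexed by vertices; only those inside
    [U] constrain a coloring of [U]. *)
Definition admissible U : {set {ffun V -> K}} :=
  [set f in list_colorings U |
    proper_in U f &&
    [forall w, (E w != set0) && (E w \subset U) ==> ~~ repetitive f (E w)]]%SET.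

Lemma proper_inP U f :
  reflect (forall x y, x \in U -> y \in U -> adj x y -> f x != f y)
          (proper_in U f).
Proof.
apply: (iffP 'forall_implyP) => [H x y xU yU xy|H x xU].
  by move/forall_inP: (H x xU) => /(_ y yU) /implyP /(_ xy).
by apply/forall_inP => y yU; apply/implyP; exact: H.
Qed.

Lemma admissibleP U f :
  reflect [/\ f \in list_colorings U,
              forall x y, x \in U -> y \in U -> adj x y -> f x != f y
            & forall w, E w != set0 -> E w \subset U -> ~~ repetitive f (E w)]
          (f \in admissible U).
Proof.
rewrite [_ \in admissible U]in_set; apply: (iffP and3P) => [[H1 /proper_inP H2 /forallP H3]|[H1 H2 H3]].
  by split=> // w Ew0 EwU; have /implyP := H3 w; apply; rewrite Ew0.
split=> //; first exact/proper_inP.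
by apply/forallP => w; apply/implyP => /andP[]; exact: H3.
Qed.

Lemma erase_admissible U v f :
  f \in admissible U -> recolor f v k0 \in admissible (U :\ v).
Proof.
move=> /admissibleP[H1 H2 H3]; apply/admissibleP.
have out x : x \in U :\ v -> (x \in U) * (recolor f v k0 x = f x).
  by rewrite !inE recolorE => /andP[/negbTE-> ->].
split=> [|x y /out[xU ->] /out[yU ->]|w Ew0 /subsetP EwU].
- exact: erase_list_colorings.
- exact: H2.
- rewrite (@eq_repetitive _ f) => [|x /EwU /out[]//].
  by apply: H3 => //; apply/subsetP => x /EwU /out[].
Qed.

Definition repetitive_admissible U e : {set {ffun V -> K}} :=
  [set f in admissible U | repetitive f e]%SET.

(** Admissibility is only asked after uncoloring [v]: these are the bad extensions
    to [v] of admissible colorings. *)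
Definition repetitive_extensions U v e : {set {ffun V -> K}} :=
  [set f in list_colorings U |
    (recolor f v k0 \in admissible (U :\ v)) && repetitive f e]%SET.

(** If the color of [v] occurs on at least two vertices of [e :\ v], then
    [e :\ v] is still repetitive and the color of [v] is one of the few colors it
    carries.  If it occurs on [u] only, then [e :\ v :\ u] is still repetitive
    and the color of [v] can be read off from [u]. *)
Lemma card_repetitive_extensions U v e : v \in e ->
  (#|repetitive_extensions U v e|
   <= #|repetitive_admissible (U :\ v) (e :\ v)| * #|e :\ v|./2
      + \sum_(u in e :\ v) #|repetitive_admissible (U :\ v) (e :\ v :\ u)|)%N.
Proof.
move=> ve.
pose A1 := repetitive_admissible (U :\ v) (e :\ v).
pose A2 u := repetitive_admissible (U :\ v) (e :\ v :\ u).
pose B1 := \bigcup_(g in A1) [set recolor g v c | c in g @: (e :\ v)].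
pose B2 := \bigcup_(u in e :\ v) [set recolor g v (g u) | g in A2 u].
have sub : repetitive_extensions U v e \subset B1 :|: B2.
  apply/subsetP => f; rewrite in_set => /and3P[_ gA /repetitiveP rep].
  set g := recolor f v k0 in gA *.
  have fg x : x \in e :\ v -> g x = f x.
    by rewrite !inE recolorE => /andP[/negbTE->].
  have fE : f = recolor g v (f v) by rewrite recolor_id.
  have [u [ue uv fu]] := rep v ve.
  have uev : u \in e :\ v by rewrite !inE uv.
  rewrite in_setU; apply/orP.
  have [/existsP[u2 /and4P[u2e u2v u2u /eqP fu2]]|] :=
    boolP [exists u2, [&& u2 \in e, u2 != v, u2 != u & f u2 == f v]].
    left; apply/bigcupP; exists g; last first.
      by rewrite fE; apply: imset_f; rewrite -fu -fg//; apply: imset_f.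
    rewrite in_set gA; apply/repetitiveP => x xev.
    have [x' [x'e x'x fx']] := rep x (subsetP (subsetDl _ _) _ xev).
    have [xv|x'v] := eqVneq x' v; last first.
      have x'ev : x' \in e :\ v by rewrite !inE x'v.
      by exists x'; split=> //; rewrite !fg.
    have [xu|xu] := eqVneq u x.
      exists u2; have u2ev : u2 \in e :\ v by rewrite !inE u2v.
      by split; rewrite -?xu// !fg// fu2 fu.
    by exists u; split=> //; rewrite !fg// -fx' xv.
  rewrite negb_exists => /forallP no3.
  right; apply/bigcupP; exists u => //; rewrite fE.
  have -> : f v = g u by rewrite fg.
  apply: imset_f; rewrite in_set gA; apply/repetitiveP => x.
  rewrite in_setD1 => /andP[xu xev]; move: (xev); rewrite in_setD1 => /andP[xv xe].
  have [x' [x'e x'x fx']] := rep x xe.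
  have fxv : f x != f v by have := no3 x; rewrite xe xv xu.
  have x'v : x' != v by apply: contraNneq fxv => <-; rewrite fx'.
  have x'u : x' != u by apply: contraNneq fxv => x'u; rewrite -fx' x'u fu.
  by exists x'; split=> //; rewrite ?fg// !inE ?x'u ?x'v.
apply: leq_trans (subset_leq_card sub) _.
apply: leq_trans (leq_card_setU _ _) _; apply: leq_add.
  apply: leq_trans (leq_card_bigcup _ _) _.
  rewrite -sum_nat_const; apply: leq_sum => g; rewrite in_set => /andP[_ rep].
  exact: leq_trans (leq_imset_card _ _) (repetitive_few_colors rep).
apply: leq_trans (leq_card_bigcup _ _) _.
by apply: leq_sum => u _; exact: leq_imset_card.
Qed.

Section Ratio.
Variables (R : realType) (b : R).
Hypothesis b_gt0 : 0 < b.

Lemma repetitive_extensions_le U v e k : v \in e -> #|e| = k.+2 ->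
  (forall e', e' \subset e :\ v ->
    #|repetitive_admissible (U :\ v) e'|%:R
      <= repeat_weight b #|e'| * #|admissible (U :\ v)|%:R) ->
  #|repetitive_extensions U v e|%:R
    <= b * repeat_weight b k.+2 * #|admissible (U :\ v)|%:R :> R.
Proof.
move=> ve ek IH.
have ev : #|e :\ v| = k.+1 by move: ek; rewrite (cardsD1 v) ve => -[].
have := card_repetitive_extensions U ve; rewrite ev -(ler_nat R) natrD natrM.
move=> H; apply: le_trans H _.
have -> : b * repeat_weight b k.+2 * #|admissible (U :\ v)|%:R
  = repeat_weight b k.+1 * #|admissible (U :\ v)|%:R * (k.+1%:R / 2)
    + repeat_weight b k * #|admissible (U :\ v)|%:R *+ k.+1.
  rewrite repeat_weightSS -[in RHS]mulr_natr; field.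
  by rewrite gt_eqF.
apply: lerD.
  apply: ler_pM => //; first by rewrite -ev; exact: IH.
  rewrite ler_pdivlMr// -natrM ler_nat muln2.
  by rewrite -[X in (_ <= X)%N]odd_double_half leq_addl.
rewrite natr_sum -ev -sumr_const; apply: ler_sum => u ue.
have := IH (e :\ v :\ u) (subsetDl _ _).
suff -> : #|e :\ v :\ u| = k by [].
by move: ev; rewrite (cardsD1 u) ue => -[].
Qed.

(** The growth hypothesis pays for the uncolored vertex: an admissible coloring
    that is repetitive on [e] extends one of [U :\ v], for any [v] in [e], and
    there are at most [#|admissible U| / b] of those. *)
Lemma repetitive_admissible_le n :
  (forall U v, (#|U| <= n)%N -> v \in U ->
    b * #|admissible (U :\ v)|%:R <= #|admissible U|%:R) ->
  forall U e, (#|U| <= n)%N -> e \subset U ->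
  #|repetitive_admissible U e|%:R <= repeat_weight b #|e| * #|admissible U|%:R.
Proof.
move=> growth U e; have [m] := ubnP #|e|; elim: m U e => // m IH U e em Un eU.
case ek : #|e| => [|[|k]].
- rewrite mul1r ler_nat subset_leq_card//; apply/subsetP => f.
  by rewrite in_set => /andP[].
- rewrite mul0r; move/eqP/cards1P: ek => [u ->].
  suff -> : repetitive_admissible U [set u] = set0 by rewrite cards0.
  by apply/setP => f; rewrite in_set (negbTE (repetitive1 f u)) andbF in_set0.
have [v ve] : exists v, v \in e by apply/card_gt0P; rewrite ek.
have vU := subsetP eU _ ve.
have cU : #|U| = #|U :\ v|.+1 by rewrite (cardsD1 v) vU.
apply: (@le_trans _ _ (#|repetitive_extensions U v e|%:R)).
  rewrite ler_nat subset_leq_card//; apply/subsetP => f.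
  rewrite in_set => /andP[fA rep]; rewrite in_set rep erase_admissible// !andbT.
  by case/admissibleP: fA.
apply: le_trans (repetitive_extensions_le ve ek _) _ => [e' e'e|].
  apply: IH.
  - by apply: leq_ltn_trans (subset_leq_card e'e) _; move: em; rewrite (cardsD1 v) ve.
  - by move: Un; rewrite cU; apply: ltnW.
  - by apply: subset_trans e'e _; exact: setSD.
rewrite [b * _]mulrC -mulrA ler_wpM2l ?repeat_weight_ge0//.
exact: growth.
Qed.

Hypothesis adj_symmetric : symmetric adj.
Hypothesis adj_irreflexive : irreflexive adj.
Hypothesis lists_large : forall v,
  b + #|[set x | adj v x]%SET|%:R + \sum_(w | v \in E w) b * repeat_weight b #|E w|
  <= #|L v|%:R.

(** Extensions avoiding the colors of the neighbors of [v] are admissible or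
    repetitive on some conflict set through [v]; the latter are bounded by
    [repetitive_extensions_le], whose hypothesis comes from the induction on
    [#|U|] because it concerns [U :\ v] only. *)
Theorem admissible_growth U v : v \in U ->
  b * #|admissible (U :\ v)|%:R <= #|admissible U|%:R.
Proof.
have [n] := ubnP #|U|; elim: n U v => // n IH U v Un vU.
have cU : #|U| = #|U :\ v|.+1 by rewrite (cardsD1 v) vU.
have Uvn : (#|U :\ v| < n)%N by rewrite cU in Un.
set C := admissible (U :\ v).
have bad w : v \in E w -> E w \subset U ->
    #|repetitive_extensions U v (E w)|%:R <= b * repeat_weight b #|E w| * #|C|%:R.
  move=> vEw EwU; case ek : #|E w| => [|[|k]].
  - by move: vEw; rewrite (cards0_eq ek) inE.
  - rewrite mulr0 mul0r; move/eqP/cards1P: ek => [u ->].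
    suff -> : repetitive_extensions U v [set u] = set0 by rewrite cards0.
    by apply/setP => f; rewrite in_set (negbTE (repetitive1 f u)) !andbF in_set0.
  apply: repetitive_extensions_le vEw ek _ => e' e'e.
  apply: (@repetitive_admissible_le #|U :\ v|) => //.
  - by move=> U' v' U'n; apply: IH; apply: leq_ltn_trans U'n Uvn.
  - by apply: subset_trans e'e _; exact: setSD.
pose S := admissible U :|:
  \bigcup_(w | (v \in E w) && (E w \subset U)) repetitive_extensions U v (E w).
have ext : (#|C| * (#|L v| - #|[set x | adj v x]%SET|) <= #|S|)%N.
  apply: (@leq_card_extensions _ _ v (fun g => g @: [set x | adj v x]%SET)).
  - move=> g /admissibleP[/list_coloringsP[_ g0] _ _]; apply: g0.
    by rewrite !inE eqxx.
  - by move=> g _; exact: leq_imset_card.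
  move=> g c gC cL cF; set f := recolor g v c.
  have gE : recolor f v k0 = g.
    case/admissibleP: gC => [/list_coloringsP[_ g0] _ _].
    have <- : g v = k0 by apply: g0; rewrite !inE eqxx.
    exact: recolor_id.
  have fv : f v = c by rewrite recolorE eqxx.
  have fx x : x != v -> f x = g x by rewrite recolorE => /negbTE ->.
  have fL : f \in list_colorings U.
    case/admissibleP: gC => [/list_coloringsP[gL g0] _ _].
    apply/list_coloringsP; split=> x xU; have [xv|xv] := eqVneq x v.
    - by rewrite xv fv.
    - by rewrite fx// gL// !inE xv.
    - by case/negP: xU; rewrite xv.
    - by rewrite fx// g0// !inE xv.
  have [/existsP[w /and3P[vw wU rep]]|none] :=
    boolP [exists w, [&& v \in E w, E w \subset U & repetitive f (E w)]].
    rewrite in_setU; apply/orP; right; apply/bigcupP; exists w; first by rewrite vw.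
    by rewrite in_set fL gE gC.
  rewrite in_setU; apply/orP; left; apply/admissibleP.
  case/admissibleP: gC => [_ gproper gE'].
  have vadj x : adj v x -> f v != f x.
    move=> vx; have xv : x != v by apply: contraTneq vx => ->; rewrite adj_irreflexive.
    rewrite fv fx//; apply: contraNneq cF => ->.
    by apply: imset_f; rewrite inE.
  split=> // [x y xU yU xy|w Ew0 EwU].
    have [xv|xv] := eqVneq x v; first by move: xy; rewrite xv => /vadj.
    have [yv|yv] := eqVneq y v.
      by move: xy; rewrite yv adj_symmetric eq_sym => /vadj.
    by rewrite !fx//; apply: gproper => //; rewrite !inE ?xv ?yv.
  have [vw|vw] := boolP (v \in E w).
    move: none; rewrite negb_exists => /forallP /(_ w).
    by rewrite vw EwU.
  rewrite (@eq_repetitive _ g) => [|x xw]; last first.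
    by rewrite fx//; apply: contraNneq vw => <-.
  apply: gE' => //; apply/subsetP => x xw; rewrite !inE (subsetP EwU)// andbT.
  by apply: contraNneq vw => <-.
have cS : #|S|%:R <= #|admissible U|%:R
    + (\sum_(w | v \in E w) b * repeat_weight b #|E w|) * #|C|%:R.
  apply: (@le_trans _ _ (#|admissible U|%:R +
    \sum_(w | (v \in E w) && (E w \subset U)) #|repetitive_extensions U v (E w)|%:R)).
    rewrite -natr_sum -natrD ler_nat.
    by apply: leq_trans (leq_card_setU _ _) _; rewrite leq_add2l leq_card_bigcup.
  rewrite lerD2l mulr_suml big_mkcondr/=; apply: ler_sum => w vw.
  case: ifP => [|_]; first exact: bad.
  by rewrite !mulr_ge0 ?repeat_weight_ge0// ltW.
have lv := lists_large v.
set T := \sum_(w | v \in E w) _ in lv cS.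
have T0 : 0 <= T.
  by apply: sumr_ge0 => w _; rewrite mulr_ge0 ?repeat_weight_ge0// ltW.
have dL : (#|[set x | adj v x]%SET| <= #|L v|)%N.
  by rewrite -(ler_nat R); have := b_gt0; lra.
have := le_trans _ cS; rewrite -(ler_nat R) natrM natrB// in ext.
move=> /(_ _ ext); have C0 : 0 <= #|C|%:R :> R by [].
by have := ler_wpM2r C0 lv; lra.
Qed.

Theorem card_admissible U : b ^+ #|U| <= #|admissible U|%:R.
Proof.
have [n] := ubnP #|U|; elim: n U => // n IH U Un.
have [->|[v vU]] := set_0Vmem U.
  rewrite cards0 expr0 ler1n card_gt0; apply/set0Pn; exists [ffun => k0].
  apply/admissibleP; split.
  - by apply/list_coloringsP; split=> x; rewrite ?inE// ffunE.
  - by move=> x y; rewrite inE.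
  - by move=> w + w0; rewrite -subset0 w0.
apply: le_trans (admissible_growth vU).
rewrite (cardsD1 v) vU exprS ler_wpM2l ?(ltW b_gt0)//; apply: IH.
by move: Un; rewrite (cardsD1 v) vU.
Qed.
End Ratio.
End Rosenfeld.

(** * Vertices of degree two *)

Section DegreeTwo.
Definition open_nbhd adj v := [set w | adj v w]%SET.

(** If [S] is repetitive, the color of [w] must repeat one of its at most
    [#|S| / 2] colors to keep it so.  If instead some color is used on one vertex
    of [S] only, then [w] can spoil that only by taking the same color. *)
Lemma card_forbidden_repetition g w S : w \notin S ->
  (#|[set c | repetitive (recolor g w c) (w |: S)]%SET| <= maxn 1 #|S|./2)%N.
Proof.
move=> wS.
have gx c x : x \in S -> recolor g w c x = g x.
  by move=> xS; rewrite recolorE; case: eqP xS wS => // -> ->.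
have gw c : recolor g w c w = c by rewrite recolorE eqxx.
have wwS : w \in w |: S by rewrite setU11.
have [rep|] := boolP (repetitive g S).
  apply: leq_trans (leq_maxr _ _); apply: leq_trans (repetitive_few_colors rep).
  apply: subset_leq_card; apply/subsetP => c; rewrite in_set => /repetitiveP/(_ w wwS).
  case=> u; rewrite in_setU1 gw => -[/predU1P[->|uS] uw]; first by rewrite eqxx in uw.
  by rewrite gx// => <-; apply: imset_f.
case/forall_inPn => z zS; rewrite negb_exists => /forallP lone.
apply: leq_trans (leq_maxl _ _); rewrite -(cards1 (g z)); apply: subset_leq_card.
apply/subsetP => c; rewrite in_set => /repetitiveP/(_ z).
case; first by rewrite in_setU1 zS orbT.
move=> u; rewrite (gx c z zS) in_setU1 => -[/predU1P[->|uS] uz].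
  by rewrite gw => ->; rewrite set11.
by rewrite gx// => guz; have := lone u; rewrite uS uz guz eqxx.
Qed.

(** Contracting one of the two edges at [w], seen on the same vertex type with [w]
    left isolated. *)
Definition contract adj w x y : rel V := fun u v =>
  [&& u != w, v != w & [|| adj u v, (u == x) && (v == y) | (u == y) && (v == x)]].

Section Contract.
Variables (adj : rel V) (U : {set V}) (w x y : V).
Hypothesis adj_sym : symmetric adj.
Hypothesis adj_irrefl : irreflexive adj.
Hypothesis adj_inU : forall u v, adj u v -> u \in U.
Hypothesis nbhd_w : open_nbhd adj w = [set x; y].
Hypothesis xy : x != y.

Let adjw u : adj w u = (u == x) || (u == y).
Proof. by have /setP/(_ u) := nbhd_w; rewrite !inE. Qed.

Let xw : x != w.
Proof. by apply/eqP => xw; have := adj_irrefl w; rewrite adjw -xw eqxx. Qed.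

Let yw : y != w.
Proof. by apply/eqP => yw; have := adj_irrefl w; rewrite adjw -yw eqxx orbT. Qed.

Lemma contract_sym : symmetric (contract adj w x y).
Proof.
move=> u v; rewrite /contract adj_sym.
by rewrite andbCA; congr [&& _, _ & _]; congr (_ || _); rewrite orbC ![(v == _) && _]andbC.
Qed.

Lemma contract_irrefl : irreflexive (contract adj w x y).
Proof.
move=> u; rewrite /contract adj_irrefl /=.
by have [->|_] := eqVneq u x; rewrite ?(negbTE xy) /= ?andbF.
Qed.

Lemma contract_in u v : contract adj w x y u v -> u \in U :\ w.
Proof.
case/and3P => uw _ H; rewrite !inE uw /=.
case/or3P: H => [/adj_inU//|/andP[/eqP -> _]|/andP[/eqP -> _]].
  by apply: (@adj_inU _ w); rewrite adj_sym adjw eqxx.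
by apply: (@adj_inU _ w); rewrite adj_sym adjw eqxx orbT.
Qed.

Lemma open_nbhd_contract v : v != w -> v != x -> v != y ->
  open_nbhd (contract adj w x y) v = open_nbhd adj v.
Proof.
move=> vw vx vy; apply/setP => u.
rewrite !inE /contract vw (negbTE vx) (negbTE vy) /= orbF.
by have [->|//] := eqVneq u w; rewrite adj_sym adjw (negbTE vx) (negbTE vy).
Qed.

Lemma degree_contract v :
  (#|open_nbhd (contract adj w x y) v| <= #|open_nbhd adj v|)%N.
Proof.
have [->|vw] := eqVneq v w.
  by rewrite (_ : open_nbhd _ w = set0) ?cards0//; apply/setP => u;
    rewrite !inE /contract eqxx.
have swap z z' : adj z w ->
    open_nbhd (contract adj w x y) z \subset z' |: (open_nbhd adj z :\ w) ->
    (#|open_nbhd (contract adj w x y) z| <= #|open_nbhd adj z|)%N.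
  move=> zw /subset_leq_card/leq_trans; apply.
  rewrite [X in (_ <= X)%N](cardsD1 w) inE zw cardsU1.
  by rewrite leq_add2r leq_b1.
have [vx|vx] := eqVneq v x.
  rewrite vx; apply: (swap x y); first by rewrite adj_sym adjw eqxx.
  apply/subsetP => u; rewrite !inE => /and3P[_ -> /or3P[-> //||]].
  - by rewrite orbT.
  - by case/andP => _ ->.
  - by rewrite (negbTE xy).
have [vy|vy] := eqVneq v y.
  rewrite vy; apply: (swap y x); first by rewrite adj_sym adjw eqxx orbT.
  apply/subsetP => u; rewrite !inE => /and3P[_ -> /or3P[-> //||]].
  - by rewrite orbT.
  - by rewrite eq_sym (negbTE xy).
  - by case/andP => _ ->.
by rewrite open_nbhd_contract.
Qed.

(** Coloring [w] last: it avoids two colors of neighbors and at most [D / 2]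
    colors for each of the neighborhoods of [x] and [y].  Both of these
    contain [w], so its color makes them conflict-free whatever the colors of
    the other neighbors of [x] and [y] are. *)
Lemma admissible_uncontract D : (2 <= D)%N ->
  (forall v, (#|open_nbhd adj v| <= D)%N) ->
  (#|admissible (contract adj w x y) (open_nbhd (contract adj w x y)) (U :\ w)|
    * (#|L w| - D.+2) <= #|admissible adj (open_nbhd adj) U|)%N.
Proof.
move=> D2 degD; set A := admissible _ _ (U :\ w).
have wU : w \in U by apply: (@adj_inU _ x); rewrite adjw eqxx.
have xU : x \in U by apply: (@adj_inU _ w); rewrite adj_sym adjw eqxx.
have yU : y \in U by apply: (@adj_inU _ w); rewrite adj_sym adjw eqxx orbT.
pose forb g z := [set c | repetitive (recolor g w c) (open_nbhd adj z)]%SET.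
have forb_le g z : adj w z -> (#|forb g z| <= D./2)%N.
  rewrite adj_sym => zw; have wz : w \in open_nbhd adj z by rewrite inE.
  rewrite /forb -(setD1K wz); apply: leq_trans (card_forbidden_repetition g _) _.
    by rewrite !inE eqxx.
  rewrite geq_max half_gt0 D2 half_leq//.
  by apply: leq_trans (degD z); rewrite [X in (_ <= X)%N](cardsD1 w) wz.
apply: (@leq_card_extensions _ _ w
  (fun g => [set g x; g y] :|: (forb g x :|: forb g y))).
- move=> g /admissibleP[/list_coloringsP[_ g0] _ _]; apply: g0.
  by rewrite !inE eqxx.
- move=> g _; rewrite -add2n.
  apply: leq_trans (leq_card_setU _ _) _; apply: leq_add.
    by rewrite cards2; case: eqP.
  apply: leq_trans (leq_card_setU _ _) _.
  apply: (@leq_trans (D./2 + D./2)); last by rewrite addnn -[X in (_ <= X)%N]odd_double_half leq_addl.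
  by apply: leq_add; apply: forb_le; rewrite adjw eqxx ?orbT.
move=> g c /admissibleP[/list_coloringsP[gL g0] gproper gE] cL.
rewrite !in_setU !negb_or !in_set1 => /andP[/andP[cx cy] /andP[fbx fby]].
set f := recolor g w c.
have fw : f w = c by rewrite recolorE eqxx.
have fE v : v != w -> f v = g v by rewrite recolorE => /negbTE ->.
have wproper v : adj w v -> f w != f v.
  by rewrite fw adjw => /predU1P[->|/eqP ->]; rewrite fE.
apply/admissibleP; split.
- apply/list_coloringsP; split=> v vU; have [vw|vw] := eqVneq v w.
  + by rewrite vw fw.
  + by rewrite fE// gL// !inE vw.
  + by case/negP: vU; rewrite vw.
  + by rewrite fE// g0// !inE vw.
- move=> u v uU vU uv.
  have [uw|uw] := eqVneq u w; first by move: uv; rewrite uw => /wproper.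
  have [vw|vw] := eqVneq v w.
    by move: uv; rewrite vw adj_sym eq_sym => /wproper.
  by rewrite !fE//; apply: gproper; rewrite ?inE ?uw ?vw// /contract uw vw uv.
- move=> v Nv0 NvU.
  have [->|vw] := eqVneq v w.
    rewrite nbhd_w; apply/repetitiveP => /(_ x); rewrite !inE eqxx => /(_ isT).
    case=> u [+ ux]; rewrite !inE (negbTE ux) /= => /eqP -> /eqP.
    rewrite !fE// eq_sym; apply/negP; apply: gproper.
    + by rewrite !inE xw.
    + by rewrite !inE yw.
    + by rewrite /contract xw yw !eqxx /= orbT.
  have [->|vx] := eqVneq v x; first by move: fbx; rewrite in_set.
  have [->|vy] := eqVneq v y; first by move: fby; rewrite in_set.
  have wNv : w \notin open_nbhd adj v.
    by rewrite inE adj_sym adjw (negbTE vx) (negbTE vy).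
  rewrite (@eq_repetitive _ g) => [|u uv]; last first.
    by rewrite fE//; apply: contraNneq wNv => <-.
  rewrite -open_nbhd_contract//; apply: gE; rewrite open_nbhd_contract//.
  apply/subsetP => u uv; rewrite !inE (subsetP NvU)// andbT.
  by apply: contraNneq wNv => <-.
Qed.
End Contract.

(** Contract vertices of degree two until none is left.  The remaining conflict
    sets have weight zero (size one) or size at least three, and each vertex lies
    in at most [D] of them, so together they cost at most [s]. *)
Theorem card_proper_conflict_free_list (R : realType) (b s : R) (D : nat) adj U :
  0 < b -> (2 <= D)%N -> 2 <= s ->
  (forall k, (3 <= k <= D)%N -> D%:R * (b * repeat_weight b k) <= s) ->
  (forall v, D%:R + b + s <= #|L v|%:R) ->
  symmetric adj -> irreflexive adj -> (forall u v, adj u v -> u \in U) ->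
  (forall v, (#|open_nbhd adj v| <= D)%N) ->
  b ^+ #|U| <= #|admissible adj (open_nbhd adj) U|%:R.
Proof.
move=> b0 D2 s2 small lists.
have [n] := ubnP #|U|; elim: n U adj => // n IH U adj Un adj_sym adj_irr adj_U degD.
have [/existsP[w /cards2P[x [y [xy Nw]]]]|no2] := boolP [exists w, #|open_nbhd adj w| == 2%N].
  have wU : w \in U.
    by apply: (@adj_U _ x); have /setP/(_ x) := Nw; rewrite !inE eqxx.
  have cU : #|U| = #|U :\ w|.+1 by rewrite (cardsD1 w) wU.
  have := @admissible_uncontract adj U w x y adj_sym adj_irr adj_U Nw D D2 degD.
  set A := admissible (contract _ _ _ _) _ _ => H.
  have bA : b ^+ #|U :\ w| <= #|A|%:R.
    apply: IH; first by rewrite cU in Un.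
    - exact: contract_sym.
    - exact: contract_irrefl.
    - by move=> u v; apply: contract_in.
    - by move=> v; apply: leq_trans (degree_contract adj_sym Nw xy v) (degD v).
  rewrite -(ler_nat R) natrM in H; apply: le_trans H.
  have Lw := lists w.
  have DL : (D.+2 <= #|L w|)%N by rewrite -(ler_nat R) -addn2 natrD; lra.
  rewrite natrB// cU exprSr; apply: ler_pM => //; rewrite ?exprn_ge0 ?(ltW b0)//.
  by rewrite -addn2 natrD; lra.
apply: card_admissible => // v.
have -> : \sum_(w | v \in open_nbhd adj w) b * repeat_weight b #|open_nbhd adj w|
   = \sum_(w in open_nbhd adj v) b * repeat_weight b #|open_nbhd adj w|.
  by apply: eq_bigl => w; rewrite !inE adj_sym.
set T := \sum_(w in _) _.
have D0 : 0 < D%:R :> R by rewrite ltr0n ltnW.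
have Ts : T <= s.
  rewrite -(ler_pM2l D0) mulr_sumr.
  apply: (@le_trans _ _ (\sum_(w in open_nbhd adj v) s)).
    apply: ler_sum => w wv; have := degD w; have s0 : 0 <= s by lra.
    case ek : #|open_nbhd adj w| => [|[|[|k]]] kD.
    - by move/cards0_eq: ek => /setP/(_ v); move: wv; rewrite !inE adj_sym => ->.
    - by rewrite /= !mulr0.
    - by move: no2; rewrite negb_exists => /forallP/(_ w); rewrite ek.
    - exact: small.
  rewrite sumr_const -[s *+ _]mulr_natl; apply: ler_wpM2r; [lra | by rewrite ler_nat].
have dv : #|open_nbhd adj v|%:R <= D%:R :> R by rewrite ler_nat.
have := lists v; rewrite -/(open_nbhd adj v); lra.
Qed.
End DegreeTwo.
End Colorings.

(** * From finite lists to the counting measure *)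

Lemma counting_ge_seq (T : choiceType) (R : realType) (A : set T) (r : R) :
  (r%:E <= counting A)%E ->
  exists s : seq T, [/\ uniq s, forall x, x \in s -> A x & r <= (size s)%:R].
Proof.
rewrite /counting; case: ifPn => [/asboolP Afin|/asboolPn Ainf].
  rewrite lee_fin => rA; exists (finmap.enum_fset (fset_set A)); split=> //.
  by move=> x; rewrite in_fset_set// inE.
move=> _; have [B BA nB] := infinite_set_fset (Num.truncn r).+1 Ainf.
exists (finmap.enum_fset B); split=> //.
by apply: ltW; apply: lt_le_trans (truncnS_gt r) _; rewrite ler_nat.
Qed.

Lemma seq_le_counting (T : choiceType) (R : realType) (A : set T) (s : seq T) :
  uniq s -> (forall x, x \in s -> A x) -> ((size s)%:R%:E <= counting A :> \bar R)%E.
Proof.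
move=> us sA; rewrite /counting; case: ifPn => [/asboolP Afin|_]; last exact: leey.
rewrite lee_fin ler_nat; apply: uniq_leq_size => // x xs.
by rewrite in_fset_set// inE; exact: sA.
Qed.

Lemma range_conditions_weaken (R : realType) (Delta : nat) (beta : R) :
      [\/ [/\ 65 / 10 * 10 ^+ 7 <= Delta%:R :> R,
              (655 * 10 ^+ 4 + 826) / 10 ^+ 7 * Delta%:R <= beta
            & beta <= Delta%:R],
          [/\ 4000 <= Delta%:R :> R,
              2 / 3 * Delta%:R <= beta
            & beta <= Delta%:R]
        | [/\ 750 <= Delta%:R :> R,
              8 / 10 * Delta%:R <= beta
            & beta <= Delta%:R]] ->
  [/\ (750 <= Delta)%N, 655 / 1000 * Delta%:R <= beta & beta <= Delta%:R].
Proof.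
rewrite -(ler_nat R); have D0 : 0 <= Delta%:R :> R by [].
by case=> -[D1 D2 D3]; split=> //; lra.
Qed.

Section FromFiniteColors.
Import mathcomp.boot.fintype mathcomp.boot.finset.

Lemma card_color_set (T : choiceType) (bs s : seq T) :
  uniq s -> {subset s <= bs} ->
  (size s <= #|[set k : seq_sub bs | ssval k \in s]%SET|)%N.
Proof.
move=> us sb; rewrite cardE -(size_map (@ssval _ bs)).
apply: uniq_leq_size => // x xs; apply/mapP; exists (SeqSub (sb x xs)) => //.
by rewrite mem_enum inE.
Qed.

Lemma not_repetitiveP (V K : finType) (f : {ffun V -> K}) (e : {set V}) :
  ~~ repetitive f e ->
  exists2 u, u \in e & forall u', u' \in e -> f u' = f u -> u' = u.
Proof.
case/forall_inPn => u ue; rewrite negb_exists => /forallP H.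
exists u => // u' u'e fu; have := H u'; rewrite u'e fu eqxx andbT negbK.
by move/eqP.
Qed.

Lemma admissible_proper_conflict_free (G : sgraph) (bs : seq color)
    (k0 : seq_sub bs) (ls : G -> seq color) (L : list_assignment G)
    (f : {ffun G -> seq_sub bs}) :
  (forall v x, x \in ls v -> L v x) ->
  f \in admissible k0 (fun v => [set k | ssval k \in ls v]%SET)
          (@adj G) (open_nbhd (@adj G)) [set: G] ->
  let phi : coloring G := [ffun v => ssval (f v)] in
  proper_conflict_free phi /\ is_list_coloring L phi.
Proof.
move=> lsL /admissibleP[/list_coloringsP[fL _] fp fcf] phi; split; first split.
- move=> v w vw; rewrite !ffunE; apply: contra (fp v w (in_setT _) (in_setT _) vw).
  by move=> /eqP/val_inj ->.
- move=> v Nv0; have [u uN uniq_u] := not_repetitiveP (fcf v Nv0 (subsetT _)).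
  exists (phi u); rewrite -[RHS](cards1 u); congr #|pred_of_set _|.
  apply/setP => w; rewrite !inE !ffunE; apply/idP/eqP => [|->].
    case/andP => vw /eqP/val_inj; apply: uniq_u; by rewrite inE.
  by rewrite eqxx andbT; move: uN; rewrite inE.
- move=> v; rewrite ffunE; apply: lsL; have := fL v (in_setT v).
  by rewrite inE.
Qed.

Theorem proper_conflict_free_list_count (R : realType) (b : R) (D : nat)
    (G : sgraph) (L : list_assignment G) :
  (750 <= D)%N -> 655 / 1000 * D%:R <= b -> b <= D%:R ->
  (max_degree G <= D)%N ->
  is_assignment (D%:R + b + Num.sqrt D%:R) L ->
  ((b ^+ #|G|)%:E <=
     counting [set phi : coloring G |
                 proper_conflict_free phi /\ is_list_coloring L phi]%classic)%E.
Proof.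
move=> D750 b_ge bD degD HL.
have /boolp.choice[ls lsP] := fun v => counting_ge_seq (HL v).
(* The extra color [c1] makes the palette [bs] inhabited even when [G] has no
   vertex. *)
pose c1 : color := exist _ 1%N isT.
pose bs := c1 :: flatten [seq ls v | v <- enum G].
have lsb v : {subset ls v <= bs}.
  move=> x xv; rewrite inE; apply/orP; right; apply/flattenP.
  by exists (ls v) => //; apply/mapP; exists v; rewrite ?mem_enum.
pose k0 : seq_sub bs := SeqSub (mem_head _ _).
pose LK (v : G) := [set k : seq_sub bs | ssval k \in ls v]%SET.
have LKs v : D%:R + b + Num.sqrt D%:R <= #|LK v|%:R.
  have [us _ /le_trans] := lsP v; apply.
  by rewrite ler_nat; apply: card_color_set us (lsb v).
have D0 : 750 <= D%:R :> R by rewrite ler_nat.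
have s2 : 2 <= Num.sqrt D%:R :> R.
  have -> : 2 = Num.sqrt (2 ^+ 2) :> R by rewrite sqrtr_sqr ger0_norm.
  by rewrite ler_sqrt//; lra.
have deg v : (#|open_nbhd (@adj G) v| <= D)%N.
  apply: leq_trans degD; exact: (leq_bigmax v).
have := @card_proper_conflict_free_list G _ k0 LK R b _ D (@adj G) [set: G]
  (large_b_gt0 D750 b_ge) (leq_trans (isT : (2 <= 750)%N) D750) s2
  (fun k => repeat_weight_small D750 b_ge bD) LKs
  (@adj_sym G) (@adj_irrefl G) (fun u v _ => in_setT u) deg.
rewrite cardsT -lee_fin => /le_trans; apply.
set A := admissible _ _ _ _ _.
pose toc (f : {ffun G -> seq_sub bs}) : coloring G := [ffun v => ssval (f v)].
have toc_inj : injective toc.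
  move=> f g /ffunP fg; apply/ffunP => v; have := fg v; rewrite !ffunE.
  exact: val_inj.
rewrite cardE -(size_map toc); apply: seq_le_counting.
  by rewrite map_inj_uniq ?enum_uniq.
move=> _ /mapP[f fA ->] /=; rewrite mem_enum in fA.
by apply: admissible_proper_conflict_free fA => v x; have [_ + _] := lsP v; apply.
Qed.
End FromFiniteColors.

Local Open Scope classical_set_scope.
Local Open Scope ring_scope.

(* The decimal 0.6550826 is written (655 * 10 ^ 4 + 826) / 10 ^ 7 because a
   numeral of that size denotes a unary natural number. *)
Theorem theorem2 (R : realType) (Delta : nat) (beta : R)
    (Delta_gt0 : (0 < Delta)%N)
    (Hbeta :
      [\/ [/\ 65 / 10 * 10 ^+ 7 <= Delta%:R :> R,
              (655 * 10 ^+ 4 + 826) / 10 ^+ 7 * Delta%:R <= beta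
            & beta <= Delta%:R],
          [/\ 4000 <= Delta%:R :> R,
              2 / 3 * Delta%:R <= beta
            & beta <= Delta%:R]
        | [/\ 750 <= Delta%:R :> R,
              8 / 10 * Delta%:R <= beta
            & beta <= Delta%:R]])
    (G : sgraph) (HG : (max_degree G <= Delta)%N)
    (L : list_assignment G)
    (HL : is_assignment
            ((Num.ceil (Delta%:R + beta + Num.sqrt (Delta%:R : R)))%:~R : R) L) :
  ((beta ^+ #|G|)%:E <=
     counting [set phi : coloring G |
                 proper_conflict_free phi /\ is_list_coloring L phi])%E.
Proof.
have [D750 b_ge bD] := range_conditions_weaken Hbeta.
apply: proper_conflict_free_list_count D750 b_ge bD HG _ => v.
by apply: le_trans (HL v); rewrite lee_fin; exact: ceil_ge.
Qed.
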